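(* Let $\mathcal{H}$ be a Hilbert space, let $\mathcal{F}=\{f_1,\dots,f_m\}\subset\mathcal{H}$, and let $V\subseteq\mathcal{H}$ be a fixed (closed) subspace. For any (closed) subspace $S\subseteq V$ we have $$\mathcal{E}(\mathcal{F},S)=\mathcal{E}(\mathbb{P}_V\mathcal{F},S)+\mathcal{E}(\mathcal{F},V).$$ As a consequence, for all (closed) subspaces $S,S'\subset V$, $$\mathcal{E}(\mathcal{F},S)\le\mathcal{E}(\mathcal{F},S')\iff\mathcal{E}(\mathbb{P}_V\mathcal{F},S)\le\mathcal{E}(\mathbb{P}_V\mathcal{F},S').$$
   Context: ''Subspace'' of a Hilbert space always means closed subspace. For a closed subspace $W$ of $\mathcal{H}$, $\mathbb{P}_W$ denotes the orthogonal projection onto $W$. For finite data $\mathcal{F}=\{f_1,\dots,f_m\}\subset\mathcal{H}$, the error of approximation by $W$ is $\mathcal{E}(\mathcal{F},W)=\sum_{i=1}^m\|f_i-\mathbb{P}_W f_i\|^2$, and $\mathbb{P}_V\mathcal{F}=\{\mathbb{P}_Vf_1,\dots,\mathbb{P}_Vf_m\}$ is the projected data (so $\mathcal{E}(\mathbb{P}_V\mathcal{F},S)=\sum_{i=1}^m\|\mathbb{P}_Vf_i-\mathbb{P}_S\mathbb{P}_Vf_i\|^2$; data are treated as indexed families). *)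

(* Defs.v *)
From HB Require Import structures.
From mathcomp Require Import all_boot all_order all_algebra.
From mathcomp Require Import complex.
From mathcomp Require Import boolp classical_sets reals topology normedtype.

Set Implicit Arguments.
Unset Strict Implicit.
Unset Printing Implicit Defensive.

Import Order.TTheory GRing.Theory Num.Theory.
Import numFieldNormedType.Exports.

Local Open Scope classical_set_scope.
Local Open Scope ring_scope.

Variant real_or_complex (R : realType) :
    forall K : numFieldType, (K -> K) -> Prop :=
| RealScalars : @real_or_complex R R idfun
| ComplexScalars : @real_or_complex R R[i] Num.conj.

(* The inner product is linear in its first argument and theta-semilinear in
   its second; the Hilbert space norm takes its values in K, so for K = R[i]
   norms are nonnegative reals viewed as complex numbers, ordered by the partial
   order of R[i], which restricts to the usual order on the reals. *)
HB.mixin Record isHilbert (K : numFieldType) (theta : K -> K) H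
    of CompleteNormedModule K H := {
  inner : {dot H for theta};
  norm_inner : forall x : H, `|x| ^+ 2 = inner x x
}.

#[short(type="hilbertType")]
HB.structure Definition Hilbert (K : numFieldType) (theta : K -> K) :=
  {H of CompleteNormedModule K H & isHilbert K theta H}.

Arguments hilbertType {K} theta.

Section Approximation.
Context {K : numFieldType} {theta : K -> K} {H : hilbertType theta}.

Definition closed_subspace (W : set H) :=
  GRing.submod_closed (mem W) /\ closed W.

(* The value of xget is the unique such y whenever W is a closed subspace and
   K is the field of real or complex numbers; 0 is a dummy default. *)
Definition orthproj (W : set H) (x : H) : H :=
  xget 0 [set y | W y /\ forall w, W w -> inner (x - y) w = 0].

Definition approx_error (m : nat) (f : 'I_m -> H) (W : set H) : K :=
  \sum_(i < m) `|f i - orthproj W (f i)| ^+ 2.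

End Approximation.

(* Main.v *)
Require Import Defs.
From HB Require Import structures.
From mathcomp Require Import all_boot all_order all_algebra.
From mathcomp Require Import complex ring.
From mathcomp Require Import boolp classical_sets reals topology normedtype.

(** The identity holds for each data point x separately.  The vector
    x - P_S x splits as (x - P_V x) + (P_V x - P_S x); the first summand is
    orthogonal to V and the second lies in V because S does, so Pythagoras
    applies.  Moreover P_S (P_V x) = P_S x: the residue x - P_S (P_V x) is the
    sum of x - P_V x, orthogonal to V hence to S, and of
    P_V x - P_S (P_V x), orthogonal to S.  The equivalence follows since the
    errors of S and S' differ from those of the projected data by the same term.

    The analytic content is that orthogonal projections onto closed subspaces
    exist ([orthproj_spec]).  Call u in W a d-almost projection of x when
    |<x - u, w>| <= d |w| for every w in W.
    - For every d > 0 there is one ([almost_proj_ex]): any u in W that minimizes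
      |x - u|^2 up to d^2, because moving u by the best multiple of w lowers
      |x - u|^2 by |<x - u, w>|^2 / |w|^2 ([sqr_inner_le]).
    - Two d-almost projections u and v are 2d-close, as one sees by taking
      w = u - v ([almost_proj_close]).
    Hence the sets of almost projections generate a Cauchy filter, and its limit
    is the projection.

    The scalar field enters only through the fact that nonempty sets of
    nonnegative scalars have infima ([real_or_complex_inf]). *)

Set Implicit Arguments.
Unset Strict Implicit.
Unset Printing Implicit Defensive.

Import Order.TTheory GRing.Theory Num.Theory.
Import numFieldNormedType.Exports.

Local Open Scope classical_set_scope.
Local Open Scope ring_scope.

(** Over the complex numbers, nonnegative elements are real, so that the infimum
    is the one of the real parts. *)
Lemma real_or_complex_inf (R : realType) (K : numFieldType)
    (theta : K -> K) (HK : real_or_complex R theta) (E : set K) :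
  E !=set0 -> (forall k, E k -> 0 <= k) ->
  exists2 d, (forall k, E k -> d <= k) &
             forall e, 0 < e -> exists2 k, E k & k < d + e.
Proof.
case: HK E => E E0 E_ge0.
  have Elb : has_lbound E by exists 0 => k /E_ge0.
  exists (inf E) => [k Ek | e e0]; first exact: ge_inf.
  by have [k Ek klt] := inf_adherent e0 (conj E0 Elb); exists k.
have ReE k : E k -> k = (complex.Re k)%:C%C.
  by move=> /E_ge0 /ger0_real /RRe_real.
pose F := [set complex.Re k | k in E].
have Flb : has_lbound F.
  by exists 0 => _ [k Ek <-]; rewrite -lecR -(ReE _ Ek) E_ge0.
have F0 : F !=set0 by case: E0 => k Ek; exists (complex.Re k), k.
exists (inf F)%:C%C => [k Ek | e e0].
  by rewrite (ReE _ Ek) lecR; apply: ge_inf => //; exists k.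
have eE : e = (complex.Re e)%:C%C by rewrite RRe_real ?gtr0_real.
have e0' : 0 < complex.Re e by rewrite -ltcR -eE.
have [_ [k Ek <-] klt] := inf_adherent e0' (conj F0 Flb).
by exists k => //; rewrite eE (ReE _ Ek) -rmorphD ltcR.
Qed.

Section Orthogonality.
Context {K : numFieldType} {theta : K -> K} {H : hilbertType theta}.
Implicit Types (W S V : set H) (x y z u v w : H).

Lemma closed_subspace0 W : closed_subspace W -> W 0.
Proof. by case=> [[+ _] _]; rewrite inE. Qed.

Lemma closed_subspaceP W (a : K) u v :
  closed_subspace W -> W u -> W v -> W (a *: u + v).
Proof.
by case=> [[_ +] _] Wu Wv => /(_ a u v); rewrite !inE; apply.
Qed.

Lemma closed_subspaceB W u v : closed_subspace W -> W u -> W v -> W (u - v).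
Proof.
by move=> HW Wu Wv; rewrite addrC -scaleN1r; apply: closed_subspaceP.
Qed.

Lemma innerDl u v w : inner (u + v) w = inner u w + inner v w.
Proof. exact: linearDl. Qed.

Lemma innerBl u v w : inner (u - v) w = inner u w - inner v w.
Proof. exact: linearBl. Qed.

Lemma innerDr u v w : inner w (u + v) = inner w u + inner w v.
Proof. exact: linearDr. Qed.

Lemma innerZl a u w : inner (a *: u) w = a * inner u w.
Proof. exact: linearZl_LR. Qed.

Lemma innerC u v : inner v u = theta (inner u v).
Proof. by rewrite hermitian_subproof expr0 mul1r. Qed.

(** Although theta is an arbitrary function here, hermitian symmetry at the zero
    vector forces theta 0 = 0. *)
Lemma inner_eq0C u v : inner u v = 0 -> inner v u = 0.
Proof.
have i0 : inner (0 : H) 0 = 0 by exact: linear0l.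
by move=> uv0; rewrite innerC uv0 -[in LHS]i0 -innerC.
Qed.

Lemma sqr_norm_pythagoras u v :
  inner u v = 0 -> `|u + v| ^+ 2 = `|u| ^+ 2 + `|v| ^+ 2.
Proof.
move=> uv0; rewrite !norm_inner innerDl !innerDr uv0 (inner_eq0C uv0).
by rewrite addr0 add0r.
Qed.

Lemma orthproj_unique W x y : closed_subspace W -> W y ->
  (forall w, W w -> inner (x - y) w = 0) -> orthproj W x = y.
Proof.
move=> HW Wy oy; apply: xget_unique => [|z [Wz oz]]; first by split.
have Wzy : W (z - y) by apply: closed_subspaceB.
apply/eqP; rewrite -subr_eq0 -normr_eq0 -sqrf_eq0 norm_inner.
have {1}-> : z - y = (x - y) - (x - z) by rewrite opprB [RHS]addrC subrKA.
by rewrite innerBl oy // oz // subrr.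
Qed.

(** Relaxing orthogonality instead of minimality: d = 0 gives exactly the
    orthogonal projection. *)
Definition almost_proj W x (d : K) :=
  [set u | W u /\ forall w, W w -> `|inner (x - u) w| <= d * `|w|].

Lemma almost_projS W x (d e : K) : d <= e ->
  almost_proj W x d `<=` almost_proj W x e.
Proof.
move=> de u [Wu pu]; split=> // w /pu /le_trans; apply.
by rewrite ler_wpM2r.
Qed.

(** Testing both residues against w = u - v and subtracting bounds |u - v|^2
    by 2 d |u - v|; this takes the place of the parallelogram law. *)
Lemma almost_proj_close W x (d : K) u v : closed_subspace W -> 0 <= d ->
  almost_proj W x d u -> almost_proj W x d v -> `|u - v| <= d *+ 2.
Proof.
move=> HW d0 [Wu pu] [Wv pv]; have Wuv := closed_subspaceB HW Wu Wv.
have [->|] := eqVneq (u - v) 0; first by rewrite normr0 mulrn_wge0.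
rewrite -normr_gt0 => uv0; rewrite -(ler_pM2r uv0) -expr2.
have -> : `|u - v| ^+ 2 = `|inner (x - v) (u - v) - inner (x - u) (u - v)|.
  rewrite -innerBl.
  have -> : (x - v) - (x - u) = u - v by rewrite opprB addrC subrKA.
  by rewrite -norm_inner ger0_norm // exprn_ge0.
rewrite mulr2n mulrDl; apply: le_trans (ler_normB _ _) _.
by apply: lerD; [exact: pv | exact: pu].
Qed.

(** Subtracting from z its component along w lowers |z|^2 by
    |<z, w>|^2 / |w|^2, which is at most the gap between |z|^2 and any lower
    bound b.  It serves twice: for b an infimum of squared distances it shows
    that near-minimizers are almost orthogonal, and for b = 0 it is the
    Cauchy-Schwarz inequality. *)
Lemma sqr_inner_le z w (b : K) : (forall t : K, b <= `|z - t *: w| ^+ 2) ->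
  `|inner z w| ^+ 2 <= (`|z| ^+ 2 - b) * `|w| ^+ 2.
Proof.
have [-> _|] := eqVneq w 0.
  by rewrite (linear0r inner) !normr0 expr0n /= mulr0.
rewrite -normr_gt0 => w0.
have W0 : 0 < inner w w by rewrite -norm_inner exprn_gt0.
(* This multiple makes z - t *: w orthogonal to w, hence as short as possible. *)
move=> /(_ (inner z w / inner w w)); set t := _ / _ => bt.
have o : inner (z - t *: w) (t *: w) = 0.
  apply: inner_eq0C; rewrite innerZl.
  suff -> : inner w (z - t *: w) = 0 by rewrite mulr0.
  by apply: inner_eq0C; rewrite innerBl innerZl divfK ?subrr ?gt_eqF.
have zE := sqr_norm_pythagoras o; rewrite subrK in zE.
have -> : `|inner z w| ^+ 2 = `|t *: w| ^+ 2 * `|w| ^+ 2.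
  rewrite normrZ normrM normfV -norm_inner (ger0_norm (exprn_ge0 _ (ltW w0))).
  by field; rewrite gt_eqF.
by apply: ler_wpM2r; [rewrite exprn_ge0 | rewrite zE lerBrDl lerD2r].
Qed.

Lemma cauchy_schwarz u v : `|inner u v| <= `|u| * `|v|.
Proof.
rewrite -(@ler_sqr K) ?nnegrE ?mulr_ge0 // exprMn.
rewrite -[X in X * _]subr0; apply: sqr_inner_le => t.
by rewrite exprn_ge0.
Qed.

Section Existence.
Context (R : realType) (HK : real_or_complex R theta).

(** Any u in W whose squared distance to x exceeds the infimum by less than
    d^2 will do, since its translates along w stay in W. *)
Lemma almost_proj_ex W x (d : K) : closed_subspace W -> 0 < d ->
  almost_proj W x d !=set0.
Proof.
move=> HW d0; pose E := [set `|x - w| ^+ 2 | w in W].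
have E0 : E !=set0 by exists (`|x - 0| ^+ 2), 0 => //; exact: closed_subspace0.
have E_ge0 k : E k -> 0 <= k by case=> w _ <-; rewrite exprn_ge0.
have [b b_lb b_inf] := real_or_complex_inf HK E0 E_ge0.
have [_ [u Wu <-] ub] := b_inf _ (exprn_gt0 2 d0).
exists u; split=> // w Ww.
rewrite -(@ler_sqr K) ?nnegrE ?mulr_ge0 ?(ltW d0) // exprMn.
apply: le_trans (sqr_inner_le _) _.
  move=> t; rewrite -addrA -opprD; apply: b_lb; exists (u + t *: w) => //.
  by rewrite addrC; exact: closed_subspaceP.
by rewrite ler_wpM2r ?exprn_ge0 // lerBlDl ltW.
Qed.

(** Almost projections for ever smaller d form a Cauchy filter; its limit y lies
    in W because W is closed, and <x - y, w> vanishes because it is approximated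
    by the small products <x - u, w>. *)
Lemma orthproj_ex W x : closed_subspace W ->
  exists2 y, W y & forall w, W w -> inner (x - y) w = 0.
Proof.
move=> HW; pose F := filter_from [set d : K | 0 < d] (almost_proj W x).
have FF : ProperFilter F.
  apply: filter_from_proper => [|d]; last exact: almost_proj_ex.
  apply: filter_from_filter => [|d e d0 e0]; first by exists 1 => /=.
  have /orP[de|ed] := real_leVge (gtr0_real d0) (gtr0_real e0).
    by exists d => // u pu; split=> //; exact: almost_projS pu.
  by exists e => // u pu; split=> //; exact: almost_projS pu.
have F_almost d : 0 < d -> F (almost_proj W x d) by move=> d0; exists d.
have Fc : cauchy F.
  apply: cauchy_exP => e e0.
  have d0 : 0 < e / 3 by rewrite divr_gt0.
  have [u pu] := almost_proj_ex x HW d0.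
  exists u; apply: filterS (F_almost _ d0) => v pv.
  rewrite -ball_normE /ball_ /=.
  apply: le_lt_trans (almost_proj_close HW (ltW d0) pu pv) _.
  rewrite [ltRHS](_ : e = e / 3 *+ 3) ?ltr_pMn2l //.
  by rewrite -mulr_natr divfK ?pnatr_eq0.
have [y Fy] : exists y : H, F --> y by apply/cvg_ex; exact: cauchy_cvg.
exists y => [|w Ww].
  apply: HW.2 => B /Fy FB.
  by have [u [[Wu _] Bu]] := filter_ex (filterI (F_almost 1 ltr01) FB); exists u.
have [->|] := eqVneq w 0; first exact: (linear0r inner).
rewrite -normr_gt0 => w0; apply/eqP; rewrite -normr_eq0; apply/negPn/negP.
rewrite normr_eq0 -normr_gt0; set c := inner _ _ => c0.
(* With d = |c| / (3 |w|), a d-almost projection u at distance less than d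
   from y would give |c| <= 2 d |w| < |c|. *)
pose d := `|c| / `|w| / 3.
have d0 : 0 < d by rewrite !divr_gt0.
have yd : F (fun u => `|y - u| < d).
  by apply: Fy; apply/nbhs_ballP; exists d => //= u; rewrite -ball_normE.
have [u [[Wu pu] yu]] := filter_ex (filterI (F_almost _ d0) yd).
suff : `|c| <= d * `|w| *+ 2.
  have cE : `|c| = d * `|w| *+ 3 by rewrite -mulr_natr /d; field; rewrite gt_eqF.
  by rewrite {1}cE ler_pMn2l // mulr_gt0.
have -> : c = inner (x - u) w - inner (y - u) w.
  by rewrite -innerBl opprB addrA subrK.
rewrite mulr2n; apply: le_trans (ler_normB _ _) _; apply: lerD; first exact: pu.
by apply: le_trans (cauchy_schwarz _ _) _; rewrite ler_wpM2r // ltW.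
Qed.

Lemma orthproj_spec W x : closed_subspace W ->
  W (orthproj W x) /\ forall w, W w -> inner (x - orthproj W x) w = 0.
Proof.
move=> HW; have [y Wy oy] := orthproj_ex x HW.
by apply: (@xgetI _ 0 [set z | W z /\ forall w, W w -> inner (x - z) w = 0] y).
Qed.

(** Both summands of x - P_S (P_V x) = (x - P_V x) + (P_V x - P_S (P_V x)) are
    orthogonal to S, so P_S (P_V x) satisfies what characterizes P_S x. *)
Lemma orthproj_comp S V x : closed_subspace S -> closed_subspace V ->
  S `<=` V -> orthproj S (orthproj V x) = orthproj S x.
Proof.
move=> HS HV SV; have [_ oV] := orthproj_spec x HV.
have [SS oS] := orthproj_spec (orthproj V x) HS.
apply/esym/orthproj_unique => // w Sw.
rewrite -[x](subrK (orthproj V x)) -addrA innerDl.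
by rewrite subrK oV ?oS ?addr0 //; exact: SV.
Qed.

Lemma sqr_dist_orthproj S V x : closed_subspace S -> closed_subspace V ->
  S `<=` V ->
  `|x - orthproj S x| ^+ 2 =
  `|orthproj V x - orthproj S (orthproj V x)| ^+ 2 + `|x - orthproj V x| ^+ 2.
Proof.
move=> HS HV SV; have [VV oV] := orthproj_spec x HV.
have [SS _] := orthproj_spec x HS.
rewrite orthproj_comp // [RHS]addrC -sqr_norm_pythagoras ?subrKA //.
exact: oV (closed_subspaceB HV VV (SV _ SS)).
Qed.

End Existence.
End Orthogonality.

Theorem theorem1 (R : realType) (K : numFieldType) (theta : K -> K)
    (HK : real_or_complex R theta) (H : hilbertType theta)
    (m : nat) (f : 'I_m -> H) (V : set H) (HV : closed_subspace V) :
  (forall S : set H, closed_subspace S -> S `<=` V ->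
     approx_error f S = approx_error (orthproj V \o f) S + approx_error f V) /\
  (forall S S' : set H, closed_subspace S -> closed_subspace S' ->
     S `<=` V -> S' `<=` V ->
     (approx_error f S <= approx_error f S' <->
      approx_error (orthproj V \o f) S <= approx_error (orthproj V \o f) S')).
Proof.
have split_error S : closed_subspace S -> S `<=` V ->
    approx_error f S = approx_error (orthproj V \o f) S + approx_error f V.
  move=> HS SV; rewrite /approx_error -big_split /=.
  by apply: eq_bigr => i _; exact: (sqr_dist_orthproj HK).
split=> // S S' HS HS' SV S'V.
by rewrite (split_error S) // (split_error S') // lerD2r.
Qed.
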